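(* Let $A=(a_{ij})_{i,j=1}^n$ be a symmetrizable generalized Cartan matrix, $\mathfrak{g}(A)$ the associated complex Kac-Moody algebra with Chevalley generators $e_i,f_i$, and $\mathfrak{k}(A)$ the fix-point Lie subalgebra of $\mathfrak{g}(A)$ with respect to the Chevalley involution. Put $Y_i:=e_i-f_i\in\mathfrak{k}(A)$ and $$\mathcal{E}_A:=\{j\in\{1,\ldots,n\}\mid a_{ij}\equiv 0\ (\mathrm{mod}\ 2)\ \ \forall\, i\in\{1,\ldots,n\}\}.$$ There is a linear isomorphism $$\mathbb{C}^{\mathcal{E}_A}\overset{\sim}{\longrightarrow}\mathrm{ch}(\mathfrak{k}(A)),\qquad \mathbf{t}=(t_j)_{j\in\mathcal{E}_A}\mapsto\chi_{\mathbf{t}},$$ where $\chi_{\mathbf{t}}\in\mathrm{ch}(\mathfrak{k}(A))$ is defined by $\chi_{\mathbf{t}}(Y_j)=t_j$ if $j\in\mathcal{E}_A$ and $\chi_{\mathbf{t}}(Y_j)=0$ if $j\notin\mathcal{E}_A$.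
   Context: Kac-Moody algebra: let $(\mathfrak{h}(A),\{\alpha_i\}_{i=1}^n,\{h_i\}_{i=1}^n)$ be a realization of $A$, i.e. $\mathfrak{h}(A)$ is a complex vector space of dimension $2n-\mathrm{rk}(A)$, and $\{\alpha_i\}\subset\mathfrak{h}(A)^*$, $\{h_i\}\subset\mathfrak{h}(A)$ are linearly independent with $\alpha_j(h_i)=a_{ij}$. $\mathfrak{g}(A)$ is the complex Lie algebra generated by $\mathfrak{h}(A)$ and $e_i,f_i$ ($1\le i\le n$) with defining relations $[h,h']=0$, $[h,e_j]=\alpha_j(h)e_j$, $[h,f_j]=-\alpha_j(h)f_j$, $[e_i,f_j]=\delta_{i,j}h_i$ for $h,h'\in\mathfrak{h}(A)$, and $(\mathrm{ad}\,e_i)^{1-a_{ij}}e_j=0=(\mathrm{ad}\,f_i)^{1-a_{ij}}f_j$ for $i\neq j$. The Chevalley involution $\omega$ is the involutive automorphism with $\omega|_{\mathfrak{h}(A)}=-\mathrm{Id}$ and $\omega(e_i)=-f_i$, and $\mathfrak{k}(A)=\{x\in\mathfrak{g}(A)\mid\omega(x)=x\}$. It is known that $Y_1,\ldots,Y_n$ generate the Lie algebra $\mathfrak{k}(A)$. $\mathrm{ch}(\mathfrak{k}(A))$ denotes the complex vector space of one-dimensional representations of $\mathfrak{k}(A)$, i.e. of linear functionals $\chi:\mathfrak{k}(A)\to\mathbb{C}$ vanishing on $[\mathfrak{k}(A),\mathfrak{k}(A)]$. *)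

(* Defs.v *)
From HB Require Import structures.
From mathcomp Require Import all_boot all_order all_algebra.
From mathcomp Require Import boolp functions reals complex.

Set Implicit Arguments.
Unset Strict Implicit.
Unset Printing Implicit Defensive.

Import GRing.Theory.
Local Open Scope ring_scope.
Local Open Scope quotient_scope.

HB.mixin Record Lmodule_isLieAlgebra (K : fieldType) L of GRing.Lmodule K L := {
  lie_br : L -> L -> L;
  lie_br_linearl : forall (a : K) (x y z : L),
    lie_br (a *: x + y) z = a *: lie_br x z + lie_br y z;
  lie_br_linearr : forall (a : K) (x y z : L),
    lie_br z (a *: x + y) = a *: lie_br z x + lie_br z y;
  lie_br_alt : forall x : L, lie_br x x = 0;
  lie_br_jacobi : forall x y z : L,
    lie_br x (lie_br y z) + lie_br y (lie_br z x) + lie_br z (lie_br x y) = 0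
}.

#[short(type="lieAlgType")]
HB.structure Definition LieAlgebra (K : fieldType) :=
  {L of GRing.Lmodule K L & Lmodule_isLieAlgebra K L}.

Notation "[ 'lie' x , y ]" := (lie_br x y)
  (at level 0, x, y at level 99, format "[ 'lie'  x ,  y ]") : ring_scope.

Section LieTheory.
Context {K : fieldType} {L : lieAlgType K}.
Implicit Types (x y z : L) (a : K).

Lemma lie_br0l x : [lie 0, x] = 0.
Proof.
by have := lie_br_linearl (-1) 0 0 x; rewrite scaler0 addr0 scaleN1r addNr.
Qed.

Lemma lie_br0r x : [lie x, 0] = 0.
Proof.
by have := lie_br_linearr (-1) 0 0 x; rewrite scaler0 addr0 scaleN1r addNr.
Qed.

Lemma lie_brDl x y z : [lie x + y, z] = [lie x, z] + [lie y, z].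
Proof. by have := lie_br_linearl 1 x y z; rewrite !scale1r. Qed.

Lemma lie_brDr x y z : [lie z, x + y] = [lie z, x] + [lie z, y].
Proof. by have := lie_br_linearr 1 x y z; rewrite !scale1r. Qed.

Lemma lie_brZl a x z : [lie a *: x, z] = a *: [lie x, z].
Proof. by have := lie_br_linearl a x 0 z; rewrite !addr0 lie_br0l addr0. Qed.

Lemma lie_brZr a x z : [lie z, a *: x] = a *: [lie z, x].
Proof. by have := lie_br_linearr a x 0 z; rewrite !addr0 lie_br0r addr0. Qed.

Lemma lie_brNl x z : [lie - x, z] = - [lie x, z].
Proof. by rewrite -scaleN1r lie_brZl scaleN1r. Qed.

Lemma lie_brNr x z : [lie z, - x] = - [lie z, x].
Proof. by rewrite -scaleN1r lie_brZr scaleN1r. Qed.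

Lemma lie_brC x y : [lie x, y] = - [lie y, x].
Proof.
apply/eqP; rewrite -addr_eq0; apply/eqP.
have := lie_br_alt (x + y).
by rewrite lie_brDl !lie_brDr !lie_br_alt add0r addr0.
Qed.

End LieTheory.

Section Characters.
Context {K : fieldType}.
Variable L : lieAlgType K.

(* The derived subalgebra [L, L], i.e. the linear span of all brackets; scalars
   are absorbed in either entry of the brackets. *)
Definition in_derived (x : L) : Prop :=
  exists s : seq (L * L), x = \sum_(p <- s) [lie p.1, p.2].

Definition is_lie_char : {pred L -> K^o} :=
  fun chi => `[< linear chi /\ forall x, in_derived x -> chi x = 0 >].

Lemma is_lie_char_submod : submod_closed is_lie_char.
Proof.
split=> [|a f g /asboolP[fL f0] /asboolP[gL g0]]; apply/asboolP.
  by split=> // a x y; rewrite scaler0 addr0.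
split=> [b x y|x dx]; last first.
  by rewrite /= !fctE f0 // g0 // scaler0 addr0.
rewrite /= !fctE fL gL !scalerDr !scalerA [a * b]mulrC.
by rewrite -!addrA; congr (_ + _); rewrite addrCA.
Qed.

HB.instance Definition _ :=
  GRing.isSubmodClosed.Build K (L -> K^o) is_lie_char is_lie_char_submod.

Record lie_char := LieChar {
  lie_char_fun :> L -> K^o;
  _ : lie_char_fun \in is_lie_char }.

HB.instance Definition _ := [isSub for lie_char_fun].
HB.instance Definition _ := [Choice of lie_char by <:].
HB.instance Definition _ := [SubChoice_isSubLmodule of lie_char by <:].

End Characters.

Inductive lie_term (K X : Type) : Type :=
| LGen of X
| LZero
| LAdd of lie_term K X & lie_term K X
| LScale of K & lie_term K X
| LBr of lie_term K X & lie_term K X.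
Arguments LGen {K X}.
Arguments LZero {K X}.

Section Presentation.
Variables (K : fieldType) (X : Type).
Local Notation T := (lie_term K X).
Variable rels : T -> T -> Prop.

(* The smallest congruence containing [rels] whose quotient is a Lie algebra. *)
Inductive lie_cong : T -> T -> Prop :=
| lc_rel t u : rels t u -> lie_cong t u
| lc_refl t : lie_cong t t
| lc_sym t u : lie_cong t u -> lie_cong u t
| lc_trans t u v : lie_cong t u -> lie_cong u v -> lie_cong t v
| lc_add t t' u u' :
    lie_cong t t' -> lie_cong u u' -> lie_cong (LAdd t u) (LAdd t' u')
| lc_scale a t t' : lie_cong t t' -> lie_cong (LScale a t) (LScale a t')
| lc_br t t' u u' :
    lie_cong t t' -> lie_cong u u' -> lie_cong (LBr t u) (LBr t' u')
| lc_addA t u v : lie_cong (LAdd t (LAdd u v)) (LAdd (LAdd t u) v)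
| lc_addC t u : lie_cong (LAdd t u) (LAdd u t)
| lc_add0 t : lie_cong (LAdd LZero t) t
| lc_addN t : lie_cong (LAdd (LScale (-1) t) t) LZero
| lc_scaleA a b t : lie_cong (LScale a (LScale b t)) (LScale (a * b) t)
| lc_scale1 t : lie_cong (LScale 1 t) t
| lc_scaleDr a t u :
    lie_cong (LScale a (LAdd t u)) (LAdd (LScale a t) (LScale a u))
| lc_scaleDl a b t :
    lie_cong (LScale (a + b) t) (LAdd (LScale a t) (LScale b t))
| lc_brl a t u v :
    lie_cong (LBr (LAdd (LScale a t) u) v) (LAdd (LScale a (LBr t v)) (LBr u v))
| lc_brr a t u v :
    lie_cong (LBr v (LAdd (LScale a t) u)) (LAdd (LScale a (LBr v t)) (LBr v u))
| lc_alt t : lie_cong (LBr t t) LZero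
| lc_jacobi t u v :
    lie_cong (LAdd (LAdd (LBr t (LBr u v)) (LBr u (LBr v t))) (LBr v (LBr t u)))
             LZero.

HB.instance Definition _ := gen_eqMixin T.
HB.instance Definition _ := gen_choiceMixin T.

Definition lie_congb : rel T := fun t u => `[< lie_cong t u >].

Lemma lie_congb_equiv : equiv_class_of lie_congb.
Proof.
split=> [t|t u|u t v]; first exact/asboolP/lc_refl.
- by apply/asboolP/asboolP; apply: lc_sym.
- by move=> /asboolP tu /asboolP uv; apply/asboolP; apply: lc_trans uv.
Qed.

Canonical lie_cong_equiv := EquivRelPack lie_congb_equiv.

Definition lie_pres := {eq_quot lie_cong_equiv}.
HB.instance Definition _ := Choice.on lie_pres.

Definition lie_pi (t : T) : lie_pres := \pi_{eq_quot lie_cong_equiv} t.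
Definition lie_repr (x : lie_pres) : T := repr x.

Lemma lie_reprK x : lie_pi (lie_repr x) = x.
Proof. exact: reprK. Qed.

Lemma lie_piP t u : lie_pi t = lie_pi u <-> lie_cong t u.
Proof.
split; first by move=> /eqmodP/asboolP.
by move=> tu; apply/eqmodP/asboolP.
Qed.

Lemma lie_repr_pi t : lie_cong (lie_repr (lie_pi t)) t.
Proof. by apply/lie_piP; rewrite lie_reprK. Qed.

Definition pres_add (x y : lie_pres) := lie_pi (LAdd (lie_repr x) (lie_repr y)).
Definition pres_scale (a : K) (x : lie_pres) := lie_pi (LScale a (lie_repr x)).
Definition pres_br (x y : lie_pres) := lie_pi (LBr (lie_repr x) (lie_repr y)).

Lemma pres_addE t u : pres_add (lie_pi t) (lie_pi u) = lie_pi (LAdd t u).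
Proof. by apply/lie_piP/lc_add; apply: lie_repr_pi. Qed.

Lemma pres_scaleE a t : pres_scale a (lie_pi t) = lie_pi (LScale a t).
Proof. by apply/lie_piP/lc_scale; apply: lie_repr_pi. Qed.

Lemma pres_brE t u : pres_br (lie_pi t) (lie_pi u) = lie_pi (LBr t u).
Proof. by apply/lie_piP/lc_br; apply: lie_repr_pi. Qed.

Let presE := (pres_addE, pres_scaleE, pres_brE).

Lemma pres_addA : associative pres_add.
Proof.
move=> x y z; rewrite -[x]lie_reprK -[y]lie_reprK -[z]lie_reprK !presE.
exact/lie_piP/lc_addA.
Qed.

Lemma pres_addC : commutative pres_add.
Proof.
move=> x y; rewrite -[x]lie_reprK -[y]lie_reprK !presE.
exact/lie_piP/lc_addC.
Qed.

Lemma pres_add0 : left_id (lie_pi LZero) pres_add.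
Proof. by move=> x; rewrite -[x]lie_reprK !presE; apply/lie_piP/lc_add0. Qed.

Lemma pres_addN : left_inverse (lie_pi LZero) (pres_scale (-1)) pres_add.
Proof. by move=> x; rewrite -[x]lie_reprK !presE; apply/lie_piP/lc_addN. Qed.

HB.instance Definition _ := GRing.isZmodule.Build lie_pres
  pres_addA pres_addC pres_add0 pres_addN.

Lemma pres_scaleA a b x : pres_scale a (pres_scale b x) = pres_scale (a * b) x.
Proof. by rewrite -[x]lie_reprK !presE; apply/lie_piP/lc_scaleA. Qed.

Lemma pres_scale1 : left_id 1 pres_scale.
Proof. by move=> x; rewrite -[x]lie_reprK !presE; apply/lie_piP/lc_scale1. Qed.

Lemma pres_scaleDr : right_distributive pres_scale +%R.
Proof.
move=> a x y; rewrite -[x]lie_reprK -[y]lie_reprK /GRing.add /= !presE.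
exact/lie_piP/lc_scaleDr.
Qed.

Lemma pres_scaleDl x : {morph pres_scale^~ x : a b / a + b}.
Proof.
move=> a b; rewrite -[x]lie_reprK [in RHS]/GRing.add /= !presE.
exact/lie_piP/lc_scaleDl.
Qed.

HB.instance Definition _ := GRing.Zmodule_isLmodule.Build K lie_pres
  pres_scaleA pres_scale1 pres_scaleDr pres_scaleDl.

Lemma lie_piD t u : lie_pi (LAdd t u) = lie_pi t + lie_pi u.
Proof. by rewrite -pres_addE. Qed.

Lemma lie_piZ a t : lie_pi (LScale a t) = a *: lie_pi t.
Proof. by rewrite -pres_scaleE. Qed.

Lemma lie_pi0 : lie_pi LZero = 0.
Proof. by []. Qed.

Lemma pres_brl a (x y z : lie_pres) :
  pres_br (a *: x + y) z = a *: pres_br x z + pres_br y z.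
Proof.
rewrite -[x]lie_reprK -[y]lie_reprK -[z]lie_reprK.
rewrite -lie_piZ -lie_piD !pres_brE -lie_piZ -lie_piD.
exact/lie_piP/lc_brl.
Qed.

Lemma pres_brr a (x y z : lie_pres) :
  pres_br z (a *: x + y) = a *: pres_br z x + pres_br z y.
Proof.
rewrite -[x]lie_reprK -[y]lie_reprK -[z]lie_reprK.
rewrite -lie_piZ -lie_piD !pres_brE -lie_piZ -lie_piD.
exact/lie_piP/lc_brr.
Qed.

Lemma pres_alt (x : lie_pres) : pres_br x x = 0.
Proof. by rewrite -[x]lie_reprK presE; apply/lie_piP/lc_alt. Qed.

Lemma pres_jacobi (x y z : lie_pres) :
  pres_br x (pres_br y z) + pres_br y (pres_br z x) + pres_br z (pres_br x y)
  = 0.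
Proof.
rewrite -[x]lie_reprK -[y]lie_reprK -[z]lie_reprK !pres_brE -!lie_piD.
exact/lie_piP/lc_jacobi.
Qed.

HB.instance Definition _ := Lmodule_isLieAlgebra.Build K lie_pres
  pres_brl pres_brr pres_alt pres_jacobi.

Lemma lie_piBr t u : lie_pi (LBr t u) = [lie lie_pi t, lie_pi u].
Proof. by rewrite -pres_brE. Qed.

Definition lie_gen (x : X) : lie_pres := lie_pi (LGen x).

Lemma lie_pi_rel t u : rels t u -> lie_pi t = lie_pi u.
Proof. by move=> r; apply/lie_piP/lc_rel. Qed.

Section Lift.
Variables (L : lieAlgType K) (f : X -> L).

Fixpoint lie_eval (t : T) : L :=
  match t with
  | LGen x => f x
  | LZero => 0
  | LAdd t u => lie_eval t + lie_eval u
  | LScale a t => a *: lie_eval t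
  | LBr t u => [lie lie_eval t, lie_eval u]
  end.

Definition lie_lift (x : lie_pres) : L := lie_eval (lie_repr x).

Hypothesis f_rels : forall t u, rels t u -> lie_eval t = lie_eval u.

Lemma lie_eval_cong t u : lie_cong t u -> lie_eval t = lie_eval u.
Proof.
elim=> {t u} //=; first by move=> t u v _ -> _ ->.
- by move=> t t' u u' _ -> _ ->.
- by move=> a t t' _ ->.
- by move=> t t' u u' _ -> _ ->.
- by move=> t u v; rewrite addrA.
- by move=> t u; rewrite addrC.
- by move=> t; rewrite add0r.
- by move=> t; rewrite scaleN1r addNr.
- by move=> a b t; rewrite scalerA.
- by move=> t; rewrite scale1r.
- by move=> a t u; rewrite scalerDr.
- by move=> a b t; rewrite scalerDl.
- by move=> a t u v; rewrite lie_br_linearl.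
- by move=> a t u v; rewrite lie_br_linearr.
- by move=> t; rewrite lie_br_alt.
- by move=> t u v; rewrite lie_br_jacobi.
Qed.

Lemma lie_lift_pi t : lie_lift (lie_pi t) = lie_eval t.
Proof. exact/lie_eval_cong/lie_repr_pi. Qed.

Lemma lie_lift_gen x : lie_lift (lie_gen x) = f x.
Proof. exact: lie_lift_pi. Qed.

Lemma lie_lift_linear : linear lie_lift.
Proof.
move=> a x y; rewrite -[x]lie_reprK -[y]lie_reprK -lie_piZ -lie_piD.
by rewrite !lie_lift_pi.
Qed.

Lemma lie_lift_br x y : lie_lift [lie x, y] = [lie lie_lift x, lie_lift y].
Proof.
by rewrite -[x]lie_reprK -[y]lie_reprK -lie_piBr !lie_lift_pi.
Qed.

End Lift.

Lemma lie_pres_ind (P : lie_pres -> Prop) :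
  (forall x, P (lie_gen x)) -> P 0 ->
  (forall x y, P x -> P y -> P (x + y)) ->
  (forall a x, P x -> P (a *: x)) ->
  (forall x y, P x -> P y -> P [lie x, y]) ->
  forall x, P x.
Proof.
move=> Pg P0 PD PZ PB x; rewrite -[x]lie_reprK.
elim: (lie_repr x) => [y||t Pt u Pu|a t Pt|t Pt u Pu].
- exact: Pg.
- exact: P0.
- by rewrite lie_piD; apply: PD.
- by rewrite lie_piZ; apply: PZ.
- by rewrite lie_piBr; apply: PB.
Qed.

End Presentation.

Definition gen_cartan_matrix n (A : 'M[int]_n) : Prop :=
  [/\ forall i, A i i = 2,
      forall i j, i != j -> A i j <= 0
    & forall i j, A i j = 0 -> A j i = 0].

Definition symmetrizable (K : fieldType) n (A : 'M[int]_n) : Prop :=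
  exists (d : 'rV[K]_n) (B : 'M[K]_n),
    [/\ forall i, d 0 i != 0, B^T = B & map_mx intr A = diag_mx d *m B].

Record realization (K : fieldType) n (A : 'M[int]_n) := Realization {
  rlz_h : vectType K;
  rlz_root : 'I_n -> 'Hom(rlz_h, K^o);
  rlz_coroot : 'I_n -> rlz_h;
  _ : \dim {:rlz_h} = (2 * n - \rank (map_mx intr A : 'M[K]_n))%N;
  _ : free [seq rlz_root i | i <- enum 'I_n];
  _ : free [seq rlz_coroot i | i <- enum 'I_n];
  _ : forall i j, rlz_root j (rlz_coroot i) = (A i j)%:~R :> K
}.

Definition root_eval (K : fieldType) n (A : 'M[int]_n) (rho : realization K A)
  (j : 'I_n) (x : rlz_h rho) : K := rlz_root rho j x.

Inductive km_gen n (h : Type) : Type :=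
| GenH of h
| GenE of 'I_n
| GenF of 'I_n.
Arguments GenH {n h}.
Arguments GenE {n h}.
Arguments GenF {n h}.

Section KacMoody.
Variables (K : fieldType) (n : nat) (A : 'M[int]_n) (rho : realization K A).
Local Notation h := (rlz_h rho).
Local Notation alpha := (@root_eval K n A rho).
Local Notation H x := (LGen (GenH x)).
Local Notation E i := (LGen (GenE i)).
Local Notation F i := (LGen (GenF i)).

(* [km_lin] makes the map from [h] to the Lie algebra linear. For a generalized
   Cartan matrix and [i != j] the absolute value in the Serre relations is
   [1 - A i j] itself. *)
Inductive km_rel :
    lie_term K (km_gen n h) -> lie_term K (km_gen n h) -> Prop :=
| km_lin a x y : km_rel (H (a *: x + y)) (LAdd (LScale a (H x)) (H y))
| km_hh x y : km_rel (LBr (H x) (H y)) LZero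
| km_he x j : km_rel (LBr (H x) (E j)) (LScale (alpha j x) (E j))
| km_hf x j : km_rel (LBr (H x) (F j)) (LScale (- alpha j x) (F j))
| km_ef i : km_rel (LBr (E i) (F i)) (H (rlz_coroot rho i))
| km_ef0 i j : i != j -> km_rel (LBr (E i) (F j)) LZero
| km_serre_e i j : i != j ->
    km_rel (iter `|1 - A i j|%N (LBr (E i)) (E j)) LZero
| km_serre_f i j : i != j ->
    km_rel (iter `|1 - A i j|%N (LBr (F i)) (F j)) LZero.

Definition kac_moody := lie_pres km_rel.
HB.instance Definition _ := LieAlgebra.on kac_moody.

Definition km_h (x : h) : kac_moody := lie_gen km_rel (GenH x).
Definition km_e (i : 'I_n) : kac_moody := lie_gen km_rel (GenE i).
Definition km_f (i : 'I_n) : kac_moody := lie_gen km_rel (GenF i).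

(* The value at [GenF i] is forced by involutivity. *)
Definition chevalley_gen (x : km_gen n h) : kac_moody :=
  match x with
  | GenH x => - km_h x
  | GenE i => - km_f i
  | GenF i => - km_e i
  end.

Lemma km_h_linear : linear km_h.
Proof.
move=> a x y; have := lie_pi_rel (km_lin a x y).
by rewrite lie_piD lie_piZ.
Qed.

Lemma km_hh_br x y : [lie km_h x, km_h y] = 0.
Proof. by have := lie_pi_rel (km_hh x y); rewrite lie_piBr lie_pi0. Qed.

Lemma km_he_br x j : [lie km_h x, km_e j] = alpha j x *: km_e j.
Proof. by have := lie_pi_rel (km_he x j); rewrite lie_piBr lie_piZ. Qed.

Lemma km_hf_br x j : [lie km_h x, km_f j] = - alpha j x *: km_f j.
Proof. by have := lie_pi_rel (km_hf x j); rewrite lie_piBr lie_piZ. Qed.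

Lemma km_ef_br i j :
  [lie km_e i, km_f j] = if i == j then km_h (rlz_coroot rho i) else 0.
Proof.
case: eqVneq => [<-|ij].
  by have := lie_pi_rel (km_ef i); rewrite lie_piBr.
by have := lie_pi_rel (km_ef0 ij); rewrite lie_piBr lie_pi0.
Qed.

Lemma lie_pi_iter m t u :
  lie_pi km_rel (iter m (LBr t) u) =
  iter m (lie_br (lie_pi km_rel t)) (lie_pi km_rel u).
Proof. by elim: m => //= m <-; rewrite lie_piBr. Qed.

Lemma km_serre_e_br i j : i != j ->
  iter `|1 - A i j|%N (lie_br (km_e i)) (km_e j) = 0.
Proof.
by move=> ij; have := lie_pi_rel (km_serre_e ij); rewrite lie_pi_iter lie_pi0.
Qed.

Lemma km_serre_f_br i j : i != j ->
  iter `|1 - A i j|%N (lie_br (km_f i)) (km_f j) = 0.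
Proof.
by move=> ij; have := lie_pi_rel (km_serre_f ij); rewrite lie_pi_iter lie_pi0.
Qed.

Lemma chevalley_rels t u : km_rel t u ->
  lie_eval chevalley_gen t = lie_eval chevalley_gen u.
Proof.
have evalN m t' u' : lie_eval chevalley_gen (iter m (LBr t') u') =
    iter m (lie_br (lie_eval chevalley_gen t')) (lie_eval chevalley_gen u').
  by elim: m => //= m ->.
have iterN m (x y : kac_moody) : iter m (lie_br x) y = 0 ->
    iter m (lie_br (- x)) (- y) = 0.
  have -> : iter m (lie_br (- x)) (- y) = (-1) ^+ m.+1 *: iter m (lie_br x) y.
    elim: m => [|m IHm] /=; first by rewrite scaleN1r.
    by rewrite IHm lie_brZr lie_brNl [in RHS]exprS -scalerA scaleN1r scalerN.
  by move=> ->; rewrite scaler0.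
case=> {t u} /=.
- by move=> a x y; rewrite km_h_linear opprD scalerN.
- by move=> x y; rewrite lie_brNl lie_brNr km_hh_br !oppr0.
- by move=> x j; rewrite lie_brNl lie_brNr km_hf_br scaleNr scalerN opprK.
- by move=> x j; rewrite lie_brNl lie_brNr km_he_br scaleNr scalerN opprK.
- by move=> i; rewrite lie_brNl lie_brNr opprK lie_brC km_ef_br eqxx.
- move=> i j ij; rewrite lie_brNl lie_brNr opprK lie_brC km_ef_br.
  by rewrite eq_sym (negPf ij) oppr0.
- by move=> i j ij; rewrite evalN; apply/iterN/km_serre_f_br.
- by move=> i j ij; rewrite evalN; apply/iterN/km_serre_e_br.
Qed.

Definition chevalley : kac_moody -> kac_moody := lie_lift chevalley_gen.

Lemma chevalley_linear : linear chevalley.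
Proof. exact: lie_lift_linear chevalley_rels. Qed.

HB.instance Definition _ :=
  GRing.isLinear.Build K kac_moody kac_moody *:%R chevalley chevalley_linear.

Lemma chevalley_br x y : chevalley [lie x, y] = [lie chevalley x, chevalley y].
Proof. exact: lie_lift_br chevalley_rels _ _. Qed.

Lemma chevalley_h x : chevalley (km_h x) = - km_h x.
Proof. exact: lie_lift_gen chevalley_rels _. Qed.

Lemma chevalley_e i : chevalley (km_e i) = - km_f i.
Proof. exact: lie_lift_gen chevalley_rels _. Qed.

Lemma chevalley_f i : chevalley (km_f i) = - km_e i.
Proof. exact: lie_lift_gen chevalley_rels _. Qed.

Lemma chevalleyK : involutive chevalley.
Proof.
elim/lie_pres_ind => [[x|i|i]||x y Hx Hy|a x Hx|x y Hx Hy].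
- by rewrite -/(km_h x) chevalley_h linearN /= chevalley_h opprK.
- by rewrite -/(km_e i) chevalley_e linearN /= chevalley_f opprK.
- by rewrite -/(km_f i) chevalley_f linearN /= chevalley_e opprK.
- by rewrite !linear0.
- by rewrite !linearD /= Hx Hy.
- by rewrite !linearZ /= Hx.
- by rewrite !chevalley_br Hx Hy.
Qed.

Definition is_fixed : {pred kac_moody} := fun x => chevalley x == x.

Lemma is_fixed_submod : submod_closed is_fixed.
Proof.
split=> [|a x y /eqP fx /eqP fy]; apply/eqP; first exact: linear0.
by rewrite linearP /= fx fy.
Qed.

HB.instance Definition _ :=
  GRing.isSubmodClosed.Build K kac_moody is_fixed is_fixed_submod.

Record km_fix := KmFix {
  km_fix_val :> kac_moody;
  _ : km_fix_val \in is_fixed }.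

HB.instance Definition _ := [isSub for km_fix_val].
HB.instance Definition _ := [Choice of km_fix by <:].
HB.instance Definition _ := [SubChoice_isSubLmodule of km_fix by <:].

Lemma is_fixed_br x y :
  x \in is_fixed -> y \in is_fixed -> [lie x, y] \in is_fixed.
Proof. by move=> /eqP fx /eqP fy; apply/eqP; rewrite chevalley_br fx fy. Qed.

Definition km_fix_br (x y : km_fix) : km_fix :=
  KmFix (is_fixed_br (valP x) (valP y)).

Lemma km_fix_brl a (x y z : km_fix) :
  km_fix_br (a *: x + y) z = a *: km_fix_br x z + km_fix_br y z.
Proof. by apply: val_inj; rewrite /= lie_br_linearl. Qed.

Lemma km_fix_brr a (x y z : km_fix) :
  km_fix_br z (a *: x + y) = a *: km_fix_br z x + km_fix_br z y.
Proof. by apply: val_inj; rewrite /= lie_br_linearr. Qed.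

Lemma km_fix_alt (x : km_fix) : km_fix_br x x = 0.
Proof. by apply: val_inj; rewrite /= lie_br_alt. Qed.

Lemma km_fix_jacobi (x y z : km_fix) :
  km_fix_br x (km_fix_br y z) + km_fix_br y (km_fix_br z x)
  + km_fix_br z (km_fix_br x y) = 0.
Proof. by apply: val_inj; rewrite /= lie_br_jacobi. Qed.

HB.instance Definition _ := Lmodule_isLieAlgebra.Build K km_fix
  km_fix_brl km_fix_brr km_fix_alt km_fix_jacobi.

Lemma km_Y_fixed i : km_e i - km_f i \in is_fixed.
Proof.
by apply/eqP; rewrite linearB /= chevalley_e chevalley_f opprK addrC.
Qed.

Definition km_Y (i : 'I_n) : km_fix := KmFix (km_Y_fixed i).

End KacMoody.

Definition even_cols n (A : 'M[int]_n) : {set 'I_n} :=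
  [set j | [forall i, (2 %| A i j)%Z]].

(* Main.v *)
Require Import Defs.
From HB Require Import structures.
From mathcomp Require Import all_boot all_order all_algebra.
From mathcomp Require Import boolp functions reals complex.
From mathcomp Require Import ring zify.

(* A character of k is determined by its values on the generators Y_i. Berman's
   relation between Y_i and Y_j involves only terms (ad Y_i)^r Y_j with r of the
   parity of 1 - a_ij, so for a_ij odd it forces chi(Y_j) = 0.

   For the existence of chi with chi(Y_j) = t_j, let the algebra defined like
   g(A) but without Serre relations act on functions on words in the f_i (the
   dual of its Verma module, twisted by the Chevalley involution). The equations
   Y_j psi = t_j psi, psi(empty word) = 1 have a unique solution psi. On the
   submodule generated by psi the Serre elements of the f's act by 0, since they
   commute with the e's and vanish on the empty word; those of the e's kill psi,
   by the Berman relation and the parity condition on t, hence kill everything,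
   since they commute with the f's and are weight vectors. So the submodule is a
   g(A)-module containing a k-eigenvector of the wanted character. *)

Set Implicit Arguments.
Unset Strict Implicit.
Unset Printing Implicit Defensive.

Import GRing.Theory Num.Theory.
Local Open Scope ring_scope.

(** * Lie algebra identities *)

Section LieIdentities.
Context {K : fieldType} {L : lieAlgType K}.
Implicit Types (x y z e f h : L) (a b : K).

Lemma lie_br_leibniz x y z :
  [lie x, [lie y, z]] = [lie [lie x, y], z] + [lie y, [lie x, z]].
Proof.
rewrite [[lie [lie x, y], z]]lie_brC [[lie x, z]]lie_brC lie_brNr.
by apply/eqP; rewrite -subr_eq0 opprD !opprK addrA addrAC lie_br_jacobi.
Qed.

Lemma iter_br0 x k : iter k (lie_br x) 0 = 0.
Proof. by elim: k => //= k ->; rewrite lie_br0r. Qed.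

Lemma lie_br_iter_comm x y z k : [lie x, y] = 0 ->
  [lie x, iter k (lie_br y) z] = iter k (lie_br y) [lie x, z].
Proof.
move=> xy; elim: k => //= k IHk.
by rewrite lie_br_leibniz xy lie_br0l add0r IHk.
Qed.

Lemma lie_weight_iter e h x a b k :
    [lie h, e] = b *: e -> [lie h, x] = a *: x ->
  [lie h, iter k (lie_br e) x] = (a + b * k%:R) *: iter k (lie_br e) x.
Proof.
move=> he hx; elim: k => [|k IHk] /=; first by rewrite mulr0 addr0.
rewrite lie_br_leibniz he IHk lie_brZl lie_brZr -scalerDl.
by congr (_ *: _); rewrite -natr1; ring.
Qed.

(** The [sl2] string through the lowest weight vector [x]: since [[f, e] = - h], each step adds one
    more weight to the coefficient, which vanishes as soon as [a + k = 0]. *)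
Lemma sl2_lowering e f h x a k :
    [lie h, e] = 2 *: e -> [lie e, f] = h ->
    [lie h, x] = a *: x -> [lie f, x] = 0 ->
  [lie f, iter k.+1 (lie_br e) x] =
    - (k.+1%:R * (a + k%:R)) *: iter k (lie_br e) x.
Proof.
move=> he ef hx fx; have fe : [lie f, e] = - h by rewrite lie_brC ef.
elim: k => [|k IHk].
  rewrite /= lie_br_leibniz fe fx lie_br0r lie_brNl hx addr0 -scaleNr.
  by congr (_ *: _); ring.
rewrite iterS lie_br_leibniz fe IHk lie_brNl (lie_weight_iter _ he hx).
rewrite lie_brZr -scaleNr.
by rewrite -scalerDl; congr (_ *: _); rewrite -!natr1; ring.
Qed.

(* In terms of [y = e - f], this is the left-hand side of Berman's relation
   of order [k] in a weight space where the coroot acts by [a]. *)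
Fixpoint berman (y x : L) (a : K) (k : nat) : L :=
  match k with
  | 0 => x
  | k'.+1 =>
    match k' with
    | 0 => [lie y, x]
    | k''.+1 => [lie y, berman y x a k'] -
                (k'%:R * (a + k''%:R)) *: berman y x a k''
    end
  end.

Lemma bermanSS y x a k : berman y x a k.+2 =
  [lie y, berman y x a k.+1] - (k.+1%:R * (a + k%:R)) *: berman y x a k.
Proof. by []. Qed.

End LieIdentities.

(** The relations common to g(A) and to the operators on word functions. Serre relations are left
    out because for the operators they have to be proved. *)
Record chevalley_system (K : fieldType) (L : lieAlgType K) n (A : 'M[int]_n)
    (e f h : 'I_n -> L) : Prop := ChevalleySystem {
  chev_he : forall i j, [lie h i, e j] = (A i j)%:~R *: e j;
  chev_hf : forall i j, [lie h i, f j] = - (A i j)%:~R *: f j;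
  chev_ef : forall i j, [lie e i, f j] = if i == j then h i else 0 }.

Lemma chevalley_system_swap (K : fieldType) (L : lieAlgType K) n
    (A : 'M[int]_n) (e f h : 'I_n -> L) :
  chevalley_system A e f h -> chevalley_system A f e (fun i => - h i).
Proof.
case=> he hf ef; split=> i j.
- by rewrite lie_brNl hf scaleNr opprK.
- by rewrite lie_brNl he scaleNr.
- by rewrite lie_brC ef eq_sym; case: eqP => [->|]; rewrite ?oppr0.
Qed.

(** * Serre elements and Berman's relation *)

Section ChevalleySystems.
Variables (K : fieldType) (L : lieAlgType K) (n : nat) (A : 'M[int]_n).
Hypothesis hA : gen_cartan_matrix A.

Lemma serre_exponent i j : i != j -> (1 - A i j = `|1 - A i j|%N :> int)%R.
Proof. by case: hA => _ + _ ij => /(_ i j ij); lia. Qed.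

Lemma chevalley_lowering (e f h : 'I_n -> L) i j k :
    chevalley_system A e f h -> i != j ->
  [lie f i, iter k.+1 (lie_br (e i)) (e j)] =
    - (k.+1%:R * ((A i j)%:~R + k%:R)) *: iter k (lie_br (e i)) (e j).
Proof.
case=> he hf ef ij; case: hA => A2 _ _; apply: (@sl2_lowering _ _ _ _ (h i)).
- by rewrite he A2.
- by rewrite ef eqxx.
- by rewrite he.
- by rewrite lie_brC ef eq_sym (negPf ij) oppr0.
Qed.

(** For [l = i] the string coefficient contains [a_ij + m], which is 0 for the exponent
    [m + 1 = 1 - a_ij]. For [l = j] only [- (ad e_i)^(m+1) h_j] remains. Any other [f_l] commutes
    with both generators. *)
Lemma serre_lowering (e f h : 'I_n -> L) i j l :
    chevalley_system A e f h -> i != j ->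
  [lie f l, iter `|1 - A i j|%N (lie_br (e i)) (e j)] = 0.
Proof.
move=> sys ij; have [he hf ef] := sys; case: hA => A2 An A0.
have eq_m := serre_exponent ij; move: (An i j ij) => Aij.
case def_m: `|1 - A i j|%N eq_m => [|m] eq_m; first by lia.
have [->|li] := eqVneq l i.
  rewrite (chevalley_lowering _ sys ij).
  have -> : (A i j)%:~R + m%:R = 0 :> K.
    by rewrite -[m%:R]/((m%:Z)%:~R) -intrD; have -> : A i j + m%:Z = 0 by lia.
  by rewrite mulr0 oppr0 scale0r.
rewrite lie_br_iter_comm; last by rewrite lie_brC ef eq_sym (negPf li) oppr0.
rewrite lie_brC ef eq_sym; case: eqVneq => [lj|];
  last by rewrite oppr0 iter_br0.
rewrite iterSr lie_brNr [[lie e i, _]]lie_brC he opprK.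
(* What remains is [(ad e_i)^m] applied to [a_ji e_i]. If [m = 0], then [a_ij = 0] and hence
   [a_ji = 0]; otherwise [ad e_i] kills [e_i]. *)
case: m def_m eq_m => [|m] _ eq_m.
  by rewrite (A0 i j) ?scale0r //; lia.
by rewrite iterSr lie_brZr lie_br_alt scaler0 iter_br0.
Qed.

(** Bracketing with [e_i - f_i] extends both strings and also produces lowering terms, with the same
    coefficient for both; these are what the recursion of [berman] subtracts. *)
Lemma berman_chevalley (e f h : 'I_n -> L) i j k :
    chevalley_system A e f h -> i != j ->
  berman (e i - f i) (e j - f j) (A i j)%:~R k =
    iter k (lie_br (e i)) (e j)
    + (-1) ^+ k.+1 *: iter k (lie_br (f i)) (f j).
Proof.
move=> sys ij; have sys' := chevalley_system_swap sys.
pose B := berman (e i - f i) (e j - f j) (A i j)%:~R.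
pose w k := iter k (lie_br (e i)) (e j) +
            (-1) ^+ k.+1 *: iter k (lie_br (f i)) (f j).
(* The recursion has order two, so two consecutive orders are carried along. *)
suff: B k = w k /\ B k.+1 = w k.+1 by case.
elim: k => [|k [IH0 IH1]]; split=> //.
- by rewrite /B /w /= expr1 scaleN1r.
- have [_ _ ef] := sys; rewrite /B /w /= lie_brDl !lie_brDr !lie_brNl !lie_brNr.
  rewrite ef [[lie f i, e j]]lie_brC ef [j == i]eq_sym (negPf ij) !oppr0.
  by rewrite addr0 add0r opprK expr2 mulrNN mulr1 scale1r.
rewrite /B bermanSS -/B IH0 IH1 /w lie_brDr !lie_brZr !lie_brDl !lie_brNl.
rewrite (chevalley_lowering _ sys ij) (chevalley_lowering _ sys' ij).
rewrite -!iterS.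
set v2 := iter k.+2 _ _; set v0 := iter k _ _.
set u2 := iter k.+2 _ (f j); set u0 := iter k _ (f j).
set c := _ * _.
have -> : (-1) ^+ k.+3 = (-1) ^+ k.+1 :> K.
  by rewrite exprS exprS mulrA mulN1r opprK mul1r.
have -> : (-1) ^+ k.+2 = - (-1) ^+ k.+1 :> K by rewrite exprS mulN1r.
set s := (-1) ^+ k.+1.
rewrite scalerBr !scaleNr !scalerN !opprK scalerDr !scalerA [c * s]mulrC.
by rewrite [_ + s *: u2]addrC addrACA addrK.
Qed.
End ChevalleySystems.

(** * Generators of the fixed subalgebra *)

Section FixedGeneration.
Variables (K : fieldType) (n : nat) (A : 'M[int]_n) (rho : realization K A).
Local Notation g := (kac_moody rho).
Local Notation k := (km_fix rho).
Local Notation e := (km_e rho).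
Local Notation f := (km_f rho).
Local Notation omega := (@chevalley K n A rho).

Lemma root_coroot i j : root_eval j (rlz_coroot rho i) = (A i j)%:~R.
Proof. by case: rho => h r c d fr fc rc; apply: rc. Qed.

Lemma root_eval_linear (j : 'I_n) :
  linear (root_eval j : rlz_h rho -> K^o).
Proof. by move=> a x y; rewrite /root_eval linearP. Qed.

Lemma km_chevalley_system :
  chevalley_system A e f (fun i => km_h (rlz_coroot rho i)).
Proof.
split=> i j; rewrite ?km_he_br ?km_hf_br ?root_coroot //.
exact: km_ef_br.
Qed.

(* The graded pieces of the positive Borel subalgebra, the Cartan subalgebra
   sitting in degree 0. *)
Inductive km_pos : nat -> g -> Prop :=
| km_pos_h x : km_pos 0 (km_h x)
| km_pos_e i : km_pos 1 (e i)
| km_pos_br i m x : km_pos m x -> km_pos m.+1 [lie e i, x]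
| km_pos_lin m a x y : km_pos m x -> km_pos m y -> km_pos m (a *: x + y).

Lemma km_h0 : km_h (0 : rlz_h rho) = 0.
Proof.
have := km_h_linear (-1) (0 : rlz_h rho) 0.
by rewrite scaler0 addr0 scaleN1r addNr.
Qed.

Lemma km_posZ m a x : km_pos m x -> km_pos m (a *: x).
Proof.
move=> px; have -> : a *: x = (a - 1) *: x + x.
  by rewrite scalerBl scale1r addrNK.
exact: km_pos_lin.
Qed.


Lemma km_pos0P x : km_pos 0 x -> exists y, x = km_h y.
Proof.
move def_m: 0%N => m px; elim: px def_m => {m x} // [x|m a x y _ IHx _ IHy m0].
  by exists x.
have [[x' ->] [y' ->]] := (IHx m0, IHy m0).
by exists (a *: x' + y'); rewrite km_h_linear.
Qed.

Lemma km_pos_weight y m x : km_pos m x -> km_pos m [lie km_h y, x].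
Proof.
elim=> {m x} [x|i|i m x px IHx|m a x z _ px _ pz].
- by rewrite km_hh_br -km_h0; apply: km_pos_h.
- by rewrite km_he_br; apply/km_posZ/km_pos_e.
- rewrite lie_br_leibniz km_he_br lie_brZl.
  by apply: km_pos_lin; apply: km_pos_br.
- by rewrite lie_br_linearr; apply: km_pos_lin.
Qed.

Lemma km_pos_lower l m x : km_pos m.+1 x -> km_pos m [lie f l, x].
Proof.
move def_m1: m.+1 => m1 px; elim: px m def_m1 => {m1 x} //.
- move=> i m [->]; rewrite lie_brC km_ef_br; case: eqP => [_|_].
    by rewrite -scaleN1r; apply/km_posZ/km_pos_h.
  by rewrite oppr0 -km_h0; apply: km_pos_h.
- move=> i m x px IHx m' [->]; rewrite lie_br_leibniz [[lie f l, e i]]lie_brC.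
  rewrite km_ef_br; set c := - _; have pN : km_pos m [lie c, x].
    rewrite /c; case: eqP => _.
      by rewrite lie_brNl -scaleN1r; apply/km_posZ/km_pos_weight.
    by rewrite oppr0 lie_br0l -(scale0r x); apply: km_posZ.
  rewrite -[[lie _, x]]scale1r; apply: km_pos_lin => //.
  (* The induction hypothesis covers positive degrees only. In degree 0, [x] is in the Cartan part,
     so [[f_l, x]] is a multiple of [f_l] and bracketing with [e_i] leads back to the Cartan
     part. *)
  case: m px IHx {pN} => [/km_pos0P[y ->] _|m px IHx]; last exact/km_pos_br/IHx.
  rewrite [[lie f l, _]]lie_brC km_hf_br scaleNr opprK lie_brZr km_ef_br.
  by case: eqP => _; [|rewrite -km_h0]; apply/km_posZ/km_pos_h.
- move=> m a x y _ IHx _ IHy m' eq_m; rewrite lie_br_linearr.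
  by apply: km_pos_lin; [apply: IHx|apply: IHy].
Qed.

(* The triangular decomposition of [g], with [n_- = omega n_+]; only spanning,
   not directness, is at stake. *)
Inductive km_tri : g -> Prop :=
| km_tri_pos m x : km_pos m x -> km_tri x
| km_tri_neg m x : km_pos m x -> km_tri (omega x)
| km_tri_lin a x y : km_tri x -> km_tri y -> km_tri (a *: x + y).

Lemma km_tri0 : km_tri 0.
Proof. by rewrite -km_h0; apply/km_tri_pos/km_pos_h. Qed.

Lemma km_triZ a x : km_tri x -> km_tri (a *: x).
Proof. by move=> tx; rewrite -[_ *: _]addr0; apply: km_tri_lin km_tri0. Qed.

Lemma km_triN x : km_tri x -> km_tri (- x).
Proof. by rewrite -scaleN1r; apply: km_triZ. Qed.

Lemma km_tri_omega x : km_tri x -> km_tri (omega x).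
Proof.
elim=> {x} [m x px|m x px|a x y _ tx _ ty].
- exact: km_tri_neg px.
- by rewrite chevalleyK; apply: km_tri_pos px.
- by rewrite linearP; apply: km_tri_lin.
Qed.

Lemma km_tri_f l m x : km_pos m x -> km_tri [lie f l, x].
Proof.
case: m => [/km_pos0P[y ->]|m px]; last exact: km_tri_pos (km_pos_lower _ px).
rewrite lie_brC km_hf_br scaleNr opprK -[f l]opprK -chevalley_e.
rewrite -linearN -linearZ.
exact/km_tri_neg/km_posZ/km_posZ/km_pos_e.
Qed.

Definition km_tri_stable z := forall x, km_tri x -> km_tri [lie z, x].

Lemma km_tri_stable_omega z :
    (forall m x, km_pos m x -> km_tri [lie z, x]) ->
    (forall m x, km_pos m x -> km_tri [lie omega z, x]) ->
  km_tri_stable z.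
Proof.
move=> sz soz x; elim=> {x} [m x|m x px|a x y _ tx _ ty]; first exact: sz.
- by rewrite -[z]chevalleyK -chevalley_br; apply/km_tri_omega/(soz m).
- by rewrite lie_br_linearr; apply: km_tri_lin.
Qed.

(** The elements that lie in the span and whose adjoint action preserves it form a subalgebra, so
    generators suffice. Membership of [[x, y]] needs stability under [x], hence the joint
    induction. *)
Lemma km_tri_all x : km_tri x.
Proof.
suff: km_tri x /\ km_tri_stable x by case.
elim/lie_pres_ind: x =>
  [[y|i|i]||x y [tx sx] [ty sy]|a x [tx sx]|x y [tx sx] [ty sy]].
- split; first exact/km_tri_pos/km_pos_h.
  have sh m x : km_pos m x -> km_tri [lie km_h y, x].
    by move=> px; apply: (km_tri_pos (km_pos_weight _ px)).
  apply: km_tri_stable_omega => // m x px.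
  by rewrite chevalley_h lie_brNl; apply/km_triN/(sh m).
- split; first exact/km_tri_pos/km_pos_e.
  apply: km_tri_stable_omega => m x px; first exact/km_tri_pos/km_pos_br/px.
  by rewrite chevalley_e lie_brNl; apply/km_triN/(km_tri_f _ px).
- split.
    rewrite -[lie_gen _ _]opprK -chevalley_e.
    exact/km_triN/km_tri_neg/km_pos_e.
  apply: km_tri_stable_omega => m x px; first exact: km_tri_f px.
  by rewrite chevalley_f lie_brNl; apply/km_triN/km_tri_pos/km_pos_br/px.
- by split=> [|z _]; rewrite ?lie_br0l; apply: km_tri0.
- split=> [|z tz]; rewrite ?lie_brDl -[X in X + _]scale1r;
    apply: km_tri_lin => //.
    exact: sx.
  exact: sy.
- split=> [|z tz]; first exact: km_triZ.
  by rewrite lie_brZl; apply/km_triZ/sx.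
- split=> [|z tz]; first exact: sx.
  have -> : [lie [lie x, y], z] = [lie x, [lie y, z]] - [lie y, [lie x, z]].
    by rewrite lie_br_leibniz addrK.
  by rewrite -[X in X - _]scale1r; apply: km_tri_lin; [|apply: km_triN]; auto.
Qed.

(** * Symmetrization under the Chevalley involution *)

Lemma km_sym_fixed x : x + omega x \in is_fixed (rho := rho).
Proof. by apply/eqP; rewrite linearD /= chevalleyK addrC. Qed.

Definition km_sym x : k := KmFix (km_sym_fixed x).

Lemma km_sym_linear : linear km_sym.
Proof.
move=> a x y; apply: val_inj; rewrite /= linearP scalerDr.
by rewrite [RHS]addrACA.
Qed.

HB.instance Definition _ :=
  GRing.isLinear.Build K g k *:%R km_sym km_sym_linear.

Lemma km_sym_omega x : km_sym (omega x) = km_sym x.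
Proof. by apply: val_inj; rewrite /= chevalleyK addrC. Qed.

Lemma km_sym_h x : km_sym (km_h x) = 0.
Proof. by apply: val_inj; rewrite /= chevalley_h subrr. Qed.

Lemma km_sym_e i : km_sym (e i) = km_Y rho i.
Proof. by apply: val_inj; rewrite /= chevalley_e. Qed.

(** Uses [omega [e_i, x] = - [f_i, omega x]] and its analogue for [f_i]. For [x] of positive degree
    the right-hand side involves only lower degrees than [[e_i, x]], which drives the induction in
    [km_fix_ind]. *)
Lemma km_sym_brY i x :
  km_sym [lie e i, x] = [lie km_Y rho i, km_sym x] + km_sym [lie f i, x].
Proof.
apply: val_inj; rewrite /= !chevalley_br chevalley_e chevalley_f.
rewrite lie_brDr !lie_brNl !lie_brDl !lie_brNl.
set a := [lie e i, x]; set b := [lie f i, x].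
set c := [lie f i, omega x]; set d := [lie e i, omega x].
by rewrite [d - c]addrC [b - d]addrC !addrA addrK [a - b - c]addrAC addrNK.
Qed.

Hypothesis char2 : 2 != 0 :> K.

(** This is generation of k by the [Y_i]. Symmetrization maps g onto k, kills the Cartan part and
    identifies the two triangular halves, so induction on the degree in the positive half is
    enough. *)
Lemma km_fix_ind (P : k -> Prop) :
    (forall i, P (km_Y rho i)) ->
    (forall a x y, P x -> P y -> P (a *: x + y)) ->
    (forall x y, P x -> P y -> P [lie x, y]) -> P 0 ->
  forall x, P x.
Proof.
move=> PY Plin Pbr P0 x.
have PZ a y : P y -> P (a *: y).
  by move=> Py; rewrite -[_ *: _]addr0; apply: Plin.
have PD y z : P y -> P z -> P (y + z) by rewrite -{2}[y]scale1r; apply: Plin.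
have Ppos m : forall y, km_pos m y -> P (km_sym y).
  elim/ltn_ind: m => -[_ y /km_pos0P[z ->]|m IH y py].
    by rewrite km_sym_h.
  move def_m1: m.+1 py => m1 py; elim: py def_m1 => {m1 y} //.
  - by move=> i _; rewrite km_sym_e.
  - move=> i m' y py _ [eq_m]; rewrite km_sym_brY.
    apply: PD; first by apply: Pbr => //; apply: (IH m') => //; rewrite eq_m.
    case: m' py eq_m => [/km_pos0P[z ->] _|m' py eq_m].
      rewrite lie_brC km_hf_br scaleNr opprK linearZ /=; apply: (PZ).
      rewrite -[f i]opprK -chevalley_e linearN /= km_sym_omega km_sym_e.
      by rewrite -scaleN1r; apply: PZ.
    by apply: (IH m'); [rewrite eq_m|apply: km_pos_lower].
  - by move=> m' a y z _ IHy _ IHz eq_m; rewrite linearP; apply: Plin; auto.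
have Pall y : P (km_sym y).
  elim: (km_tri_all y) => {y} [m y|m y py|a y z _ Py _ Pz]; first exact: Ppos.
  - by rewrite km_sym_omega; apply: (Ppos m).
  - by rewrite linearP; apply: Plin.
(* Symmetrizing doubles a fixed element, hence the factor one half. *)
have -> : x = km_sym (2^-1 *: val x).
  apply: val_inj; rewrite /= linearZ /= (eqP (valP x)) -scalerDl.
  by rewrite -mulr2n -[2^-1 *+ 2]mulr_natl mulfV // scale1r.
exact: Pall.
Qed.
End FixedGeneration.

(** * The general linear Lie algebra *)

Section GeneralLinear.
Variables (K : fieldType) (V : lmodType K).

Definition is_endo : {pred V -> V} := fun u => `[< linear u >].

Lemma is_endo_submod : submod_closed is_endo.
Proof.
split=> [|a u v /asboolP ul /asboolP vl]; apply/asboolP.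
  by move=> b x y; rewrite /= scaler0 addr0.
move=> b x y; rewrite !fctE ul vl !scalerDr !scalerA [a * b]mulrC -!addrA.
by congr (_ + _); rewrite addrCA.
Qed.

HB.instance Definition _ :=
  GRing.isSubmodClosed.Build K (V -> V) is_endo is_endo_submod.

Record gl := Gl { gl_fun :> V -> V; _ : gl_fun \in is_endo }.

HB.instance Definition _ := [isSub for gl_fun].
HB.instance Definition _ := [Choice of gl by <:].
HB.instance Definition _ := [SubChoice_isSubLmodule of gl by <:].

Lemma gl_linear (u : gl) : linear u.
Proof. exact/asboolP/(valP u). Qed.

HB.instance Definition _ (u : gl) :=
  GRing.isLinear.Build K V V *:%R u (gl_linear u).

Lemma gl_eqP (u v : gl) : u =1 v -> u = v.
Proof. by move=> uv; apply/val_inj/funext. Qed.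

Lemma glD (u v : gl) x : (u + v) x = u x + v x. Proof. by []. Qed.

Lemma glZ a (u : gl) x : (a *: u) x = a *: u x. Proof. by []. Qed.

Lemma gl_comm_endo (u v : gl) : (fun x => u (v x) - v (u x)) \in is_endo.
Proof.
apply/asboolP => a x y; rewrite !gl_linear. rewrite [in RHS]scalerBr opprD.
by rewrite [RHS]addrACA.
Qed.

Definition gl_br (u v : gl) : gl := Gl (gl_comm_endo u v).

Lemma gl_brE (u v : gl) x : gl_br u v x = u (v x) - v (u x).
Proof. by []. Qed.

Lemma gl_br_linearl a (u v w : gl) :
  gl_br (a *: u + v) w = a *: gl_br u w + gl_br v w.
Proof.
apply: gl_eqP => x; rewrite !(glD, glZ, gl_brE) gl_linear scalerBr opprD.
by rewrite [LHS]addrACA.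
Qed.

Lemma gl_br_linearr a (u v w : gl) :
  gl_br w (a *: u + v) = a *: gl_br w u + gl_br w v.
Proof.
apply: gl_eqP => x; rewrite !(glD, glZ, gl_brE) gl_linear scalerBr opprD.
by rewrite [LHS]addrACA.
Qed.

Lemma gl_br_alt (u : gl) : gl_br u u = 0.
Proof. by apply: gl_eqP => x; rewrite gl_brE subrr. Qed.

Lemma gl_br_jacobi (u v w : gl) :
  gl_br u (gl_br v w) + gl_br v (gl_br w u) + gl_br w (gl_br u v) = 0.
Proof.
apply: gl_eqP => x; rewrite !(glD, gl_brE) !linearB /= !opprK.
set a := u (v (w x)); set b := u (w (v x)); set c := v (u (w x)).
set d := w (u (v x)); set e := v (w (u x)); set f := w (v (u x)).
rewrite !addrA (addrAC _ f e) addrNK (addrAC _ b d) addrNK (addrAC _ (- a) c).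
rewrite (addrAC _ (- f) c) (addrAC _ b c) addrNK (addrAC _ f b) addrNK.
by rewrite addrK subrr.
Qed.

HB.instance Definition _ := Lmodule_isLieAlgebra.Build K gl
  gl_br_linearl gl_br_linearr gl_br_alt gl_br_jacobi.

Lemma gl_linearZ (u : gl) a x : u (a *: x) = a *: u x.
Proof. exact: linearZ. Qed.

Lemma gl_br_eq (u v w : gl) :
  (forall x, u (v x) = v (u x) + w x) -> [lie u, v] = w.
Proof.
by move=> uv; apply: gl_eqP => x; rewrite [LHS]gl_brE uv addrC addKr.
Qed.

End GeneralLinear.

(** * The module of word functions *)

Section WordModule.
Variables (K : fieldType) (n : nat) (A : 'M[int]_n) (rho : realization K A).
Local Notation alpha := (@root_eval K n A rho).
Local Notation wordfun := (seq 'I_n -> K^o).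
Implicit Types (p q : wordfun) (w : seq 'I_n) (x y : rlz_h rho).

Definition word_e i p : wordfun := fun w => p (i :: w).

Definition word_h x p : wordfun := fun w => - (\sum_(l <- w) alpha l x) * p w.

Fixpoint word_f_rec i w p : K :=
  match w with
  | [::] => 0
  | j :: w' => word_f_rec i w' (word_e j p)
               + if i == j then word_h (rlz_coroot rho i) p w' else 0
  end.

(* [p w] is the value of a functional [p] on the monomial [w] in the [f_i] of the
   Verma module of highest weight 0; [word_e], [word_h], [word_f] are the
   transposes of the actions of [f_i], [h], [e_i]. *)
Definition word_f i p : wordfun := fun w => word_f_rec i w p.

Lemma word_e_linear i : linear (word_e i). Proof. by []. Qed.

Lemma word_h_linear x : linear (word_h x).
Proof.
move=> a p q; apply/funext => w; rewrite /word_h !fctE.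
by rewrite mulrDr /GRing.scale /=; ring.
Qed.

Lemma word_f_linear i : linear (word_f i).
Proof.
move=> a p q; apply/funext => w; rewrite !fctE /word_f.
elim: w p q => [|j w IHw] p q /=; first by rewrite scaler0 addr0.
rewrite word_e_linear IHw; case: eqP => _; last by rewrite !addr0.
by rewrite word_h_linear !fctE scalerDr addrACA.
Qed.

Lemma word_ef i j p :
  word_e i (word_f j p) =
  word_f j (word_e i p) + if i == j then word_h (rlz_coroot rho i) p else 0.
Proof.
apply/funext => w; rewrite !fctE eq_sym /word_e /word_f /=.
by congr (_ + _); case: eqP => [->|].
Qed.

Lemma word_eh i x p :
  word_e i (word_h x p) = word_h x (word_e i p) + - alpha i x *: word_e i p.
Proof.
apply/funext => w; rewrite !fctE /word_e /word_h big_cons.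
by rewrite /GRing.scale /=; ring.
Qed.

Lemma word_hh x y p : word_h x (word_h y p) = word_h y (word_h x p).
Proof. by apply/funext => w; rewrite /word_h mulrCA. Qed.

Lemma word_hf x j p :
  word_h x (word_f j p) = word_f j (word_h x p) + - alpha j x *: word_f j p.
Proof.
apply/funext => w; rewrite !fctE; elim: w p => [|i w IHw] p.
  by rewrite /word_h /word_f /= mulr0 scaler0 addr0.
(* Evaluation at [i :: w] is evaluation of [word_e i] at [w]; moving [word_e i] inwards reduces the
   claim to [w]. *)
rewrite -[LHS]/(word_e i (word_h x (word_f j p)) w).
rewrite -[word_f j p (i :: w)]/(word_e i (word_f j p) w).
rewrite -[word_f j _ (i :: w)]/(word_e i (word_f j (word_h x p)) w).
rewrite word_eh !word_ef word_eh [_ + _ *: word_e i p]addrC word_f_linear.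
have hD q r : word_h x (q + r) = word_h x q + word_h x r.
  by rewrite -{1}[q]scale1r word_h_linear scale1r.
rewrite hD !fctE IHw; case: eqVneq => [->|_].
  by rewrite word_hh /GRing.scale /=; ring.
have -> : word_h x 0 = 0 by apply/funext => w'; rewrite /word_h mulr0.
have -> : (0 : wordfun) w = 0 by [].
by rewrite /GRing.scale /=; ring.
Qed.

Lemma word_h_lin a x y p : word_h (a *: x + y) p = a *: word_h x p + word_h y p.
Proof.
apply/funext => w; rewrite !fctE /word_h.
under eq_bigr do rewrite root_eval_linear /GRing.scale /=.
by rewrite big_split /= -mulr_sumr /GRing.scale /=; ring.
Qed.

(** * The joint eigenfunction and the submodule it generates *)

Variable t : 'I_n -> K.

(** A fixed point solves [Y_j p = t_j p] with value 1 on the empty word. The value at [j :: w']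
    depends only on values at words no longer than [w'], so iterates at a word settle after one step
    more than its length. *)
Definition eigen_step p : wordfun := fun w =>
  match w with
  | [::] => 1
  | j :: w' => word_f j p w' + t j * p w'
  end.

Definition eigenword : wordfun :=
  fun w => iter (size w).+1 eigen_step 0 w.

Lemma word_f_local i p q w :
    (forall w', (size w' <= size w)%N -> p w' = q w') ->
  word_f i p w = word_f i q w.
Proof.
rewrite /word_f; elim: w p q => //= j w IHw p q pq; congr (_ + _).
  by apply: IHw => w' le_w; apply: pq.
by case: eqP => // _; rewrite /word_h pq.
Qed.

Lemma eigen_iter_local N p q w : (size w < N)%N ->
  iter N eigen_step p w = iter N eigen_step q w.
Proof.
elim: N w => // N IHN [|j w] //= lt_w; congr (_ + _ * _); last exact: IHN.
by apply: word_f_local => w' le_w; apply/IHN/(leq_ltn_trans le_w).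
Qed.

Lemma eigenword_iter N w : (size w < N)%N ->
  eigenword w = iter N eigen_step 0 w.
Proof.
move=> lt_w; rewrite -(subnKC lt_w) iterD; exact: eigen_iter_local.
Qed.

Lemma eigenword_nil : eigenword [::] = 1. Proof. by []. Qed.

Lemma word_e_eigenword j :
  word_e j eigenword = word_f j eigenword + t j *: eigenword.
Proof.
apply/funext => w; rewrite !fctE /word_e {1}/eigenword iterS {1}/eigen_step.
congr (_ + _).
by apply: word_f_local => w' le_w; rewrite -eigenword_iter //= ltnS.
Qed.

(** Closure under [word_e] is derived in [ws_e] from the eigenvector equation. Having no constructor
    for it leaves only [h] and [f] to handle when an operator is shown to vanish on the span. *)
Inductive word_span : wordfun -> Prop :=
| ws_eigen : word_span eigenword
| ws_h x p : word_span p -> word_span (word_h x p)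
| ws_f i p : word_span p -> word_span (word_f i p)
| ws_lin a p q : word_span p -> word_span q -> word_span (a *: p + q).

Lemma ws_0 : word_span 0.
Proof.
have -> : 0 = -1 *: eigenword + eigenword by rewrite scaleN1r addNr.
by apply: ws_lin; apply: ws_eigen.
Qed.

Lemma ws_Z a p : word_span p -> word_span (a *: p).
Proof. by move=> wp; rewrite -[_ *: _]addr0; apply: ws_lin ws_0. Qed.

Lemma ws_D p q : word_span p -> word_span q -> word_span (p + q).
Proof. by rewrite -{2}[p]scale1r; apply: ws_lin. Qed.

Lemma ws_e i p : word_span p -> word_span (word_e i p).
Proof.
elim=> {p} [|x p wp we|j p wp we|a p q _ wep _ weq].
- rewrite word_e_eigenword; apply: ws_D; first exact/ws_f/ws_eigen.
  exact/ws_Z/ws_eigen.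
- by rewrite word_eh; apply: ws_D; [apply: ws_h|apply: ws_Z].
- rewrite word_ef; apply: ws_D; first exact: ws_f.
  by case: eqP => _; [apply: ws_h|apply: ws_0].
- by rewrite word_e_linear; apply: ws_lin.
Qed.

Definition in_word_span : {pred wordfun} := fun p => `[< word_span p >].

Lemma word_span_submod : submod_closed in_word_span.
Proof.
split=> [|a p q /asboolP wp /asboolP wq]; apply/asboolP; first exact: ws_0.
exact: ws_lin.
Qed.

HB.instance Definition _ :=
  GRing.isSubmodClosed.Build K wordfun in_word_span word_span_submod.

Record eigenmod := Eigenmod {
  eigenmod_val :> wordfun;
  _ : eigenmod_val \in in_word_span }.

HB.instance Definition _ := [isSub for eigenmod_val].
HB.instance Definition _ := [Choice of eigenmod by <:].
HB.instance Definition _ := [SubChoice_isSubLmodule of eigenmod by <:].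

Section Restriction.
Variables (op : wordfun -> wordfun) (op_lin : linear op).
Hypothesis op_stable : forall p, word_span p -> word_span (op p).

Lemma eigen_op_stable (v : eigenmod) : op v \in in_word_span.
Proof. exact/asboolP/op_stable/asboolP/(valP v). Qed.

Definition eigen_fun (v : eigenmod) : eigenmod := Eigenmod (eigen_op_stable v).

Lemma eigen_fun_endo : eigen_fun \in is_endo (V := eigenmod).
Proof. by apply/asboolP => a u v; apply: val_inj; rewrite /= op_lin. Qed.

Definition eigen_op : gl eigenmod := Gl eigen_fun_endo.
End Restriction.

Definition eigen_e i := eigen_op (word_e_linear i) (@ws_e i).
Definition eigen_f i := eigen_op (word_f_linear i) (@ws_f i).
Definition eigen_h x := eigen_op (word_h_linear x) (@ws_h x).

Definition eigenvec : eigenmod := Eigenmod (introT (asboolP _) ws_eigen).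
End WordModule.

(** * Existence of characters *)

Section EigenRepresentation.
Variables (K : fieldType) (n : nat) (A : 'M[int]_n) (rho : realization K A).
Hypothesis hA : gen_cartan_matrix A.
Variable t : 'I_n -> K.
Local Notation V := (eigenmod rho t).
Local Notation e := (eigen_e rho t).
Local Notation f := (eigen_f rho t).
Local Notation h := (@eigen_h K n A rho t).
Local Notation v0 := (eigenvec rho t).

Lemma eigen_h_lin a x y : h (a *: x + y) = a *: h x + h y.
Proof. by apply: gl_eqP => p; apply/val_inj/word_h_lin. Qed.

Lemma eigen_hh x y : [lie h x, h y] = 0.
Proof.
apply: gl_br_eq => p; apply: val_inj => /=.
by rewrite word_hh addr0.
Qed.

Lemma eigen_he x j : [lie h x, e j] = root_eval j x *: e j.
Proof.
apply: gl_br_eq => p; apply: val_inj => /=.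
by rewrite word_eh scaleNr addrNK.
Qed.

Lemma eigen_hf x j : [lie h x, f j] = - root_eval j x *: f j.
Proof. by apply: gl_br_eq => p; apply: val_inj; rewrite /= word_hf. Qed.

Lemma eigen_ef i j :
  [lie e i, f j] = if i == j then h (rlz_coroot rho i) else 0.
Proof.
apply: gl_br_eq => p; apply: val_inj; rewrite /= word_ef.
by case: eqP.
Qed.

Lemma eigen_chevalley_system :
  chevalley_system A e f (fun i => h (rlz_coroot rho i)).
Proof.
by split=> i j; rewrite ?eigen_he ?eigen_hf ?root_coroot // eigen_ef.
Qed.

Lemma eigen_e_val i (p : V) w : val (e i p) w = val p (i :: w).
Proof. by []. Qed.

Lemma eigen_f_nil i (p : V) : val (f i p) [::] = 0.
Proof. by []. Qed.

Lemma eigen_serre_f i j : i != j ->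
  iter `|1 - A i j|%N (lie_br (f i)) (f j) = 0.
Proof.
move=> ij; set S := iter _ _ _.
have Se l : [lie e l, S] = 0.
  exact: serre_lowering (chevalley_system_swap eigen_chevalley_system) ij.
have S_nil p : val (S p) [::] = 0.
  rewrite /S; elim: `|_|%N p => [|k IHk] p; first by rewrite eigen_f_nil.
  rewrite iterS gl_brE -[LHS]/(val (f i _) [::] - val _ [::]).
  by rewrite eigen_f_nil IHk subr0.
apply: gl_eqP => p; apply: val_inj; apply/funext => w /=.
(* The value of [S p] at [l :: w] is that of [e_l (S p) = S (e_l p)] at [w], so letters are stripped
   until the empty word. *)
elim: w p => [|l w IHw] p; first exact: S_nil.
rewrite -eigen_e_val; have -> : e l (S p) = S (e l p).
  by apply/eqP; rewrite -subr_eq0 -gl_brE -[gl_br _ _]/[lie e l, S] Se.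
exact: IHw.
Qed.

Lemma eigenvec_Y j : (e j - f j) v0 = t j *: v0.
Proof.
apply: val_inj; rewrite /= word_e_eigenword.
by rewrite addrAC subrr add0r.
Qed.

(** If [u] has [v0] as an eigenvector, then [[Y_i, u]] kills [v0]. The recursion thus becomes a
    scalar one linking orders [k] and [k + 2], started by [t_j] in order 0 and by 0 in order 1. *)
Lemma berman_eigenvec i j k : exists c,
  berman (e i - f i) (e j - f j) (A i j)%:~R k v0 = c *: v0 /\
  (odd k \/ t j = 0 -> c = 0).
Proof.
set B := berman _ _ _.
suff: forall k, (exists c, B k v0 = c *: v0 /\ (odd k \/ t j = 0 -> c = 0)) /\
  (exists c, B k.+1 v0 = c *: v0 /\ (odd k.+1 \/ t j = 0 -> c = 0)).
  by move=> /(_ k)[].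
have brY (u : gl V) c : u v0 = c *: v0 -> [lie e i - f i, u] v0 = 0.
  move=> uv; rewrite gl_brE uv.
rewrite (gl_linearZ _ c) (eigenvec_Y i) (gl_linearZ u) uv.
by rewrite !scalerA mulrC subrr.
elim=> {k} [|k [IH0 IH1]]; split=> //.
- by exists (t j); split; [apply: eigenvec_Y|case].
- exists 0; split=> //; rewrite scale0r /B /=.
  exact: brY _ _ (eigenvec_Y j).
have [[c0 [B0 c00]] [c1 [B1 _]]] := (IH0, IH1).
exists (- (k.+1%:R * ((A i j)%:~R + k%:R)) * c0); split; last first.
  by rewrite /= negbK => /c00 ->; rewrite mulr0.
rewrite /B bermanSS -/B -scaleNr glD glZ (brY _ _ B1) add0r B0.
by rewrite scalerA.
Qed.

Hypothesis even_t : forall j, j \notin even_cols A -> t j = 0.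

Lemma eigen_serre_e i j : i != j ->
  iter `|1 - A i j|%N (lie_br (e i)) (e j) = 0.
Proof.
move=> ij; set S := iter _ _ _.
have Sf l : [lie f l, S] = 0.
  exact: serre_lowering eigen_chevalley_system ij.
have Sh x : exists c, [lie h x, S] = c *: S.
  by eexists; apply: lie_weight_iter; apply: eigen_he.
have S_eigen : S v0 = 0.
  have [c []] := berman_eigenvec i j `|1 - A i j|%N.
  rewrite (berman_chevalley hA _ eigen_chevalley_system ij) eigen_serre_f //.
  rewrite scaler0 addr0 -/S => -> ->; first by rewrite scale0r.
  (* Either [a_ij] is even and the order [1 - a_ij] is odd, or [t_j = 0]. *)
  have [|] := boolP (j \in even_cols A); last by move=> /even_t; right.
  rewrite inE => /forallP/(_ i) Aij; left.
  by have := serre_exponent hA ij; move: Aij; lia.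
apply: gl_eqP => -[p wp]; rewrite -[RHS]/0.
(* Quantifying over [q] frees the induction on [word_span] from the membership proof. The [h] and
   [f] cases use [Sh] and [Sf] to move [S] inwards. *)
suff Sp : forall q : V, val q = p -> S q = 0 by apply: Sp.
move: wp => /asboolP.
elim=> {p} [|x p wp IHp|l p wp IHp|a p q wp IHp wq IHq] q' q'E.
- by rewrite (_ : q' = v0) //; apply: val_inj.
- pose q : V := Eigenmod (introT (asboolP _) wp).
  have -> : q' = h x q by apply: val_inj.
  have [c] := Sh x; move=> /(congr1 (fun u : gl V => u q)).
  rewrite gl_brE glZ IHp // scaler0 linear0 sub0r => /eqP.
  by rewrite oppr_eq0 => /eqP.
- pose q : V := Eigenmod (introT (asboolP _) wp).
  have -> : q' = f l q by apply: val_inj.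
  have := congr1 (fun u : gl V => u q) (Sf l).
  rewrite gl_brE IHp // linear0 sub0r => /eqP.
  by rewrite oppr_eq0 => /eqP.
- pose p1 : V := Eigenmod (introT (asboolP _) wp).
  pose q1 : V := Eigenmod (introT (asboolP _) wq).
  have -> : q' = a *: p1 + q1 by apply: val_inj.
  by rewrite linearP /= IHp // IHq // scaler0 addr0.
Qed.

Definition eigen_gen (x : km_gen n (rlz_h rho)) : gl V :=
  match x with GenH x => h x | GenE i => e i | GenF i => f i end.

Lemma eigen_rels u v : km_rel u v ->
  lie_eval eigen_gen u = lie_eval eigen_gen v.
Proof.
have evalN m t' u' : lie_eval eigen_gen (iter m (LBr t') u') =
    iter m (lie_br (lie_eval eigen_gen t')) (lie_eval eigen_gen u').
  by elim: m => //= m ->.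
case=> {u v} [a x y|x y|x j|x j|i|i j ij|i j ij|i j ij]; rewrite ?evalN /=.
- exact: eigen_h_lin.
- exact: eigen_hh.
- exact: eigen_he.
- exact: eigen_hf.
- by rewrite eigen_ef eqxx.
- by rewrite eigen_ef (negPf ij).
- exact: eigen_serre_e.
- exact: eigen_serre_f.
Qed.

Definition eigen_rep : kac_moody rho -> gl V := lie_lift eigen_gen.

Lemma eigen_rep_linear : linear eigen_rep.
Proof. exact: lie_lift_linear eigen_rels. Qed.

Lemma eigen_rep_br x y : eigen_rep [lie x, y] = [lie eigen_rep x, eigen_rep y].
Proof. exact: lie_lift_br eigen_rels x y. Qed.

Lemma eigen_rep0 : eigen_rep 0 = 0.
Proof.
by have := eigen_rep_linear (-1) 0 0; rewrite scaler0 addr0 scaleN1r addNr.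
Qed.

Lemma eigen_rep_Y i : eigen_rep (val (km_Y rho i)) = e i - f i.
Proof.
have -> : val (km_Y rho i) = -1 *: km_f rho i + km_e rho i.
  by rewrite /= scaleN1r addrC.
rewrite eigen_rep_linear /eigen_rep !(lie_lift_gen eigen_rels).
by rewrite scaleN1r addrC.
Qed.

Hypothesis char2 : 2 != 0 :> K.

(** The eigenvalue of [x] on [v0], read off at the empty word, where [v0] takes the value 1. *)
Definition eigen_char (x : km_fix rho) : K^o := val (eigen_rep (val x) v0) [::].

(** Having [v0] as an eigenvector passes to linear combinations and to commutators, where the
    eigenvalue is 0, so the generators [Y_i] suffice. *)
Lemma eigen_rep_fix (x : km_fix rho) :
  eigen_rep (val x) v0 = (eigen_char x : K) *: v0.
Proof.
suff [c xE] : exists c : K, eigen_rep (val x) v0 = c *: v0.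
  suff -> : eigen_char x = c by [].
  by rewrite /eigen_char xE /= fctE eigenword_nil /GRing.scale /= mulr1.
elim/(@km_fix_ind K n A rho char2): x =>
  [i|a x y [c xE] [d yE]|x y [c xE] [d yE]|].
- by exists (t i); rewrite eigen_rep_Y eigenvec_Y.
- exists (a * c + d); rewrite -[val _]/(a *: val x + val y) eigen_rep_linear.
  by rewrite glD glZ xE yE scalerDl scalerA.
- exists 0; rewrite -[val _]/[lie val x, val y] eigen_rep_br gl_brE.
  rewrite xE yE (gl_linearZ _ c) (gl_linearZ _ d) xE yE.
  by rewrite !scalerA mulrC subrr scale0r.
- by exists 0; rewrite -[val _]/(0 : kac_moody rho) eigen_rep0 scale0r.
Qed.

Lemma eigen_char_linear : linear eigen_char.
Proof.
move=> a x y; rewrite /eigen_char -[val (a *: x + y)]/(a *: val x + val y).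
rewrite eigen_rep_linear glD glZ.
by move: (_ v0) (_ v0).
Qed.

Lemma eigen_char_br x y : eigen_char [lie x, y] = 0.
Proof.
rewrite /eigen_char -[val [lie x, y]]/[lie val x, val y] eigen_rep_br gl_brE.
rewrite !eigen_rep_fix !gl_linearZ !eigen_rep_fix.
by rewrite !scalerA mulrC subrr.
Qed.

Lemma eigen_char_Y i : eigen_char (km_Y rho i) = t i.
Proof.
rewrite /eigen_char eigen_rep_Y eigenvec_Y /= fctE eigenword_nil.
exact: mulr1.
Qed.

Lemma eigen_char_lie_char : eigen_char \in is_lie_char (L := km_fix rho).
Proof.
apply/asboolP; split; first exact: eigen_char_linear.
move=> _ [s ->]; elim: s => [|p s IHs].
  by rewrite big_nil /eigen_char -[val 0]/(0 : kac_moody rho) eigen_rep0.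
rewrite big_cons -[X in X + _]scale1r eigen_char_linear eigen_char_br IHs.
by rewrite scaler0 addr0.
Qed.

End EigenRepresentation.

Lemma lie_char_exists (K : fieldType) n (A : 'M[int]_n) (rho : realization K A)
    (t : 'I_n -> K) :
    2 != 0 :> K -> gen_cartan_matrix A ->
    (forall j, j \notin even_cols A -> t j = 0) ->
  exists chi : lie_char (km_fix rho), forall j, chi (km_Y rho j) = t j.
Proof.
move=> char2 hA even_t.
exists (LieChar (eigen_char_lie_char rho hA even_t char2)) => j.
exact: eigen_char_Y.
Qed.

(** * The space of characters *)

Section Characters.
Variables (K : fieldType) (L : lieAlgType K).
Implicit Types (chi : lie_char L) (x y : L).

Lemma lie_char_linear chi : linear chi.
Proof. by case: chi => chi /= /asboolP[]. Qed.

Lemma lie_char_br chi x y : chi [lie x, y] = 0.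
Proof.
case: chi => chi /= /asboolP[_]; apply.
by exists [:: (x, y)]; rewrite big_seq1.
Qed.

Lemma lie_char0 chi : chi 0 = 0.
Proof.
by have := lie_char_linear chi (-1) 0 0; rewrite !scaleN1r !oppr0 !addr0 addNr.
Qed.
End Characters.

(** * Characters of k and their values on the generators *)

Section FixedCharacters.
Variables (K : numFieldType) (n : nat) (A : 'M[int]_n) (rho : realization K A).
Hypothesis hA : gen_cartan_matrix A.
Implicit Types chi : lie_char (km_fix rho).

Lemma km_fix_char_inj chi chi' :
  (forall j, chi (km_Y rho j) = chi' (km_Y rho j)) -> chi = chi'.
Proof.
move=> eqY; apply/val_inj/funext.
apply: km_fix_ind => [|//|a x y xE yE|x y _ _|].
- by rewrite pnatr_eq0.
- by rewrite /= !lie_char_linear; congr (_ *: _ + _).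
- by rewrite /= !lie_char_br.
- by rewrite /= !lie_char0.
Qed.

(** Berman's relation, computed in g(A), where both Serre elements vanish. *)
Lemma km_fix_berman i j : i != j ->
  berman (km_Y rho i) (km_Y rho j) (A i j)%:~R `|1 - A i j|%N = 0.
Proof.
move=> ij; have valB k : val (berman (km_Y rho i) (km_Y rho j) (A i j)%:~R k) =
    berman (km_e rho i - km_f rho i) (km_e rho j - km_f rho j) (A i j)%:~R k.
  set B := berman _ _ _; set B' := berman _ _ _.
  suff: val (B k) = B' k /\ val (B k.+1) = B' k.+1 by case.
  elim: k => [|k [IH0 IH1]]; split=> //.
  by rewrite /B /B' !bermanSS -/B -/B' -IH0 -IH1.
apply: val_inj; rewrite valB.
rewrite (berman_chevalley hA _ (km_chevalley_system rho) ij).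
by rewrite km_serre_e_br // km_serre_f_br // scaler0 addr0.
Qed.

(* If [A i j] is odd, Berman's relation has even order, so modulo brackets it is
   a nonzero multiple of [Y_j]. *)
Lemma km_fix_char_odd chi j : j \notin even_cols A -> chi (km_Y rho j) = 0.
Proof.
rewrite inE negb_forall => /existsP[i Aij].
have ij : i != j.
  by apply: contraNneq Aij => ->; case: hA => ->.
have eq_m := serre_exponent hA ij.
have := congr1 chi (km_fix_berman ij); rewrite lie_char0.
set m := `|_|%N in eq_m *; have -> : m = m./2.*2 by lia.
(* The orders descend by two to order 0, which is [Y_j]. The bound [2p + 2 <= m = 1 - a_ij] keeps
   the factor [a_ij + 2p] of the coefficient negative. *)
have : (m./2.*2 <= m)%N by lia.
elim: m./2 => // p IHp le_p; rewrite doubleS bermanSS addrC -scaleNr.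
rewrite lie_char_linear lie_char_br addr0 => /eqP.
rewrite scaler_eq0 oppr_eq0 mulf_eq0 pnatr_eq0 /=.
rewrite -[(p.*2)%:R]/((p.*2%:Z)%:~R) -intrD intr_eq0.
case/orP => [/eqP|/eqP]; first by lia.
by apply: IHp; lia.
Qed.

Definition char_values chi : {ffun {j : 'I_n | j \in even_cols A} -> K^o} :=
  [ffun j => chi (km_Y rho (val j))].

Lemma char_values_linear : linear char_values.
Proof. by move=> a chi chi'; apply/ffunP => j; rewrite !ffunE. Qed.

Lemma char_values_inj : injective char_values.
Proof.
move=> chi chi' /ffunP eq_v; apply: km_fix_char_inj => j.
have [jE|jE] := boolP (j \in even_cols A); last by rewrite !km_fix_char_odd.
by have := eq_v (exist _ j jE); rewrite !ffunE.
Qed.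

Lemma char_values_surj t : exists chi, char_values chi = t.
Proof.
pose t' j := if insub j is Some j' then t j' else 0 : K.
have [|//|j jE|chi chiE] := @lie_char_exists _ _ _ rho t'.
- by rewrite pnatr_eq0.
- by rewrite /t' insubN.
by exists chi; apply/ffunP => j; rewrite ffunE chiE /t' valK.
Qed.

End FixedCharacters.

Theorem proposition2p9 (R : realType) (n : nat) (A : 'M[int]_n)
    (hA : gen_cartan_matrix A) (symA : symmetrizable R[i] A)
    (rho : realization R[i] A) :
  exists Phi : {linear {ffun {j : 'I_n | j \in even_cols A} -> R[i]^o} ->
                       lie_char (km_fix rho)},
    bijective Phi /\
    forall (t : {ffun {j : 'I_n | j \in even_cols A} -> R[i]^o})
           (chi : lie_char (km_fix rho)),
      chi = Phi t <->
      (forall j : {j : 'I_n | j \in even_cols A}, chi (km_Y rho (val j)) = t j)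
      /\ (forall j : 'I_n, j \notin even_cols A -> chi (km_Y rho j) = 0).
Proof.
pose res := @char_values _ _ _ rho.
(* The isomorphism is the inverse of evaluation on the [Y_j] with [j] in [even_cols A]; its
   linearity follows from that of evaluation by injectivity. *)
pose phi t : lie_char (km_fix rho) := projT1 (cid (char_values_surj rho hA t)).
have phiK : cancel phi res.
  by move=> t; exact: projT2 (cid (char_values_surj rho hA t)).
have resK : cancel res phi.
  by move=> chi; apply: char_values_inj => //; apply: phiK.
have phi_lin : linear phi.
  move=> a t u; apply: (can_inj resK).
  by rewrite phiK /res char_values_linear -/res !phiK.
pose phiL := GRing.isLinear.Build _ _ _ _ phi phi_lin.
pose Phi : {linear _ -> _} := HB.pack phi phiL.
exists Phi; split; first by exists res.
move=> t chi; split=> [->|[tE _]].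
  split=> j; last exact: km_fix_char_odd.
  by have /ffunP/(_ j) := phiK t; rewrite ffunE.
apply: (can_inj resK); rewrite [RHS]phiK.
by apply/ffunP => j; rewrite ffunE.
Qed.
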